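(* Let $n\ge 1$ be an integer, let $(Y,+)$ be an $(n!)$-divisible Abelian group, let $U:=\mathbb{R}\setminus\{k\pi \mid k\in\mathbb{Z}\}$, and let $X:=(-\infty,0]$ be the semigroup under addition of real numbers. Let $f:U\to Y$ be a function. Then $f$ satisfies $$f(u)+\sum_{i=1}^{n+1}(-1)^{i}\binom{n+1}{i} f\left(\arcsin\left|\sin u\,\sin^{i}v\right|\right)=0\quad\text{for all }u,v\in U$$ if and only if there exist monomials $\rho_i\in\mathcal{M}_i(X,Y)$ for $i\in\{0,1,\dots,n\}$ such that $$f(u)=\sum_{i=0}^{n}\rho_i\left(\ln|\sin u|\right)\quad\text{for all }u\in U.$$
   Context: An Abelian group $(Y,+)$ is called $(n!)$-divisible if the homomorphism $Y\to Y$, $y\mapsto (n!)y$, is an isomorphism (so it is bijective). For a commutative semigroup $(X,+)$, a nonnegative integer $j$, $y\in X$ and $\rho:X\to Y$, put $\Delta_y^{j}\rho(x):=\sum_{i=0}^{j}(-1)^{j-i}\binom{j}{i}\rho(x+iy)$ for $x\in X$ (the term $i=0$ is $\rho(x)$ up to sign). The set $\mathcal{M}_j(X,Y)$ of $j$-monomials consists of all functions $\rho:X\to Y$ with $\Delta_y^{j}\rho(x)=(j!)\rho(y)$ for all $x,y\in X$ (for $j=0$: the constant functions). Here $\sin^{i}v$ means $(\sin v)^{i}$, and $\arcsin:[-1,1]\to[-\pi/2,\pi/2]$ is the principal branch. *)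

(* Defs.v *)
From HB Require Import structures.
From mathcomp Require Import all_boot all_order all_algebra.
From mathcomp Require Import all_classical all_reals all_analysis.

Set Implicit Arguments.
Unset Strict Implicit.
Unset Printing Implicit Defensive.

Import Order.TTheory GRing.Theory Num.Theory.

Local Open Scope classical_set_scope.
Local Open Scope ring_scope.

Definition divisible (m : nat) (Y : zmodType) : Prop :=
  bijective (fun y : Y => y *+ m).

(* An addSemigroupType is commutative but need not have a zero; x + iy is
   therefore obtained by adding y to x i times, which is x for i = 0. *)
Definition Delta (X : addSemigroupType) (Y : zmodType) (j : nat) (y : X)
    (rho : X -> Y) (x : X) : Y :=
  \sum_(0 <= i < j.+1)
    rho (iter i (fun z => z + y) x) *~ ((-1) ^+ (j - i) * 'C(j, i)%:Z).

Definition monomials (j : nat) (X : addSemigroupType) (Y : zmodType) :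
    set (X -> Y) :=
  [set rho | forall x y : X, Delta j y rho x = rho y *+ j`!].

Arguments monomials : clear implicits.

(* The additive semigroup ]-oo, 0]. *)
Record nonpos (R : realType) : Type :=
  Nonpos { nonpos_val :> R; nonpos_le0 : nonpos_val <= 0 }.

Arguments Nonpos {R} nonpos_val nonpos_le0.

Section NonposSemigroup.
Variable R : realType.

HB.instance Definition _ := [isSub for @nonpos_val R].
HB.instance Definition _ := [Choice of nonpos R by <:].

Fact nonpos_add_le0 (x y : nonpos R) : (x : R) + (y : R) <= 0.
Proof.
by rewrite -[leRHS]addr0; apply: lerD; exact: nonpos_le0.
Qed.

Definition nonpos_add (x y : nonpos R) : nonpos R :=
  Nonpos _ (nonpos_add_le0 x y).

Fact nonpos_addC : commutative nonpos_add.
Proof. by move=> x y; apply: val_inj; exact: addrC. Qed.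

Fact nonpos_addA : associative nonpos_add.
Proof. by move=> x y z; apply: val_inj; exact: addrA. Qed.

HB.instance Definition _ :=
  Algebra.isAddSemigroup.Build (nonpos R) nonpos_addC nonpos_addA.

End NonposSemigroup.

(* The set of reals that are not integer multiples of pi. *)
Record nonpi (R : realType) : Type :=
  Nonpi { nonpi_val :> R;
          nonpi_neq : ~ exists k : int, nonpi_val = k%:~R * pi }.

Arguments Nonpi {R} nonpi_val nonpi_neq.
Arguments nonpi_neq {R} n.

Section NonpiTheory.
Variable R : realType.
Implicit Types u v : nonpi R.

Fact sin_nat_mul_pi (n : nat) : sin (n%:R * pi) = 0 :> R.
Proof.
elim: n => [|n IHn]; first by rewrite mul0r sin0.
by rewrite -natr1 mulrDl mul1r sinDpi IHn oppr0.
Qed.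

Fact sin_int_mul_pi (k : int) : sin (k%:~R * pi) = 0 :> R.
Proof.
case: k => n; first by rewrite -pmulrn sin_nat_mul_pi.
by rewrite NegzE mulrNz mulNr sinN -pmulrn sin_nat_mul_pi oppr0.
Qed.

Fact nonpi_sin_neq0 u : sin u != 0.
Proof.
apply/eqP => su0; apply: (nonpi_neq u).
have pi0 : (0 : R) < pi := pi_gt0 R.
pose k := Num.floor ((u : R) / pi).
exists k; set t : R := k%:~R * pi.
have /andP[le_k lt_k] := floor_itv ((u : R) / pi).
have t_le : t <= (u : R) by rewrite /t -ler_pdivlMr.
have lt_t : (u : R) < t + pi.
  have : (u : R) < (k + 1)%:~R * pi by rewrite -ltr_pdivrMr.
  by rewrite intrD mulrDl mul1r.
apply/eqP; rewrite eq_le t_le andbT leNgt; apply/negP => t_lt.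
have : 0 < sin ((u : R) - t).
  by apply: sin_gt0_pi; rewrite subr_gt0 t_lt ltrBlDl.
by rewrite sinB su0 sin_int_mul_pi mul0r mulr0 subr0 ltxx.
Qed.

Fact asin_sin_nonpi u v (i : nat) :
  ~ exists k : int, asin `|sin u * sin v ^+ i| = k%:~R * pi :> R.
Proof.
move=> [k e]; have := nonpi_sin_neq0 u; have := nonpi_sin_neq0 v.
set s := `|sin u * sin v ^+ i| in e * => sv su.
have s0 : s != 0 by rewrite /s normr_eq0 mulf_neq0// expf_neq0.
have s_le1 : s <= 1.
  rewrite /s normrM normrX mulr_ile1 ?exprn_ge0 ?exprn_ile1 //.
  - by rewrite ler_norml sin_geN1 sin_le1.
  - by rewrite ler_norml sin_geN1 sin_le1.
have : sin (asin s) = s.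
  apply: asinK; rewrite in_itv/= s_le1 andbT.
  by rewrite (@le_trans _ _ 0)// /s.
by rewrite e sin_int_mul_pi => /esym/eqP; rewrite (negbTE s0).
Qed.

Fact ln_sin_le0 u : ln `|sin u| <= 0 :> R.
Proof. by rewrite ln_le0// ler_norml sin_geN1 sin_le1. Qed.

End NonpiTheory.

Arguments asin_sin_nonpi {R} u v i.

(* Main.v *)
Require Import Defs.
From HB Require Import structures.
From mathcomp Require Import all_boot all_order all_algebra.
From mathcomp Require Import all_classical all_reals all_analysis.
From mathcomp Require Import ring lra zify.

Set Implicit Arguments.
Unset Strict Implicit.
Unset Printing Implicit Defensive.

Import Order.TTheory GRing.Theory Num.Theory.

Local Open Scope classical_set_scope.
Local Open Scope ring_scope.

(**
Every [u] in the domain enters the equation only through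
[x = ln |sin u| <= 0], since [arcsin |sin u sin^i v| = arcsin (exp (x + i y))]
with [y = ln |sin v|].  Put [F x = f (arcsin (exp x))].  Taking [v] with
[|sin v| = 1] makes the alternating binomial coefficients cancel and gives
[f u = F (ln |sin u|)]; the equation then says exactly that the differences of
[F] of order [n + 1] vanish on the half-line ([sin_eq_fdiff]).  It remains to
prove the theorem of Fréchet and Djoković there: such an [F] is a sum of
monomials of degrees [0] to [n] ([fdiff_null_decomposition]).

The leading monomial has to be [rho y = (n!)^-1 Delta_y^n F 0], and the
decomposition follows by induction on [n] once [Delta_z^n rho = n! rho z],
that is, once [Delta_z^n rho x = Delta_z^n F 0 = Delta_z^n F x].  Two facts
give this.

The first is that [Delta_z^n F] is constant, i.e. [Delta_w Delta_z^n F = 0]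
([fdiff_iter_fdiff_null]).  As [Y] may have [(n + 1)]-torsion, polarization by
division in [Y] is not available; division takes place in the half-line
instead.  Following Djoković, one considers for [i = 0, ..., n + 1] the mixed
differences of [F] with the steps [(j - i) d_j], where [j = 1, ..., n + 1].
When the product of the differences is expanded, each term runs with [i]
through an arithmetic progression, so the alternating binomial sum over [i]
vanishes; for [i = 1, ..., n + 1] the step with [j = i] is zero, so only
[i = 0] survives, and this is the mixed difference with the arbitrary steps
[j d_j].  Some of the steps are positive, so that the argument works only far
to the left of [0].  Since the values of a function annihilated by the
differences of order [n + 1] are determined by those far to the left
([fdiff_null_eq0]), the conclusion extends to the whole half-line.

The second is a computation.  Expanding [Delta_y^n F 0] as a combination of
the values [F (k y)] and applying [Delta_z^n], which turns [F (k y)] into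
[Delta_{kz}^n F], that is [k^n Delta_z^n F], leaves the sum
[sum_k (-1)^(n-k) C(n,k) k^n = n!] ([iter_fdiff_diag]).
*)

(** * Alternating binomial sums *)

Section Altsum.
Variable Y : zmodType.
Implicit Types (G H : nat -> Y) (m n : nat).

Definition altsum m G : Y :=
  \sum_(0 <= i < m.+1) G i *~ ((-1) ^+ (m - i) * 'C(m, i)%:Z).

Lemma eq_altsum m G H : (forall i, (i <= m)%N -> G i = H i) ->
  altsum m G = altsum m H.
Proof.
move=> e; rewrite /altsum !big_mkord; apply: eq_bigr => i _.
by rewrite e// -ltnS.
Qed.

Lemma altsum0 G : altsum 0 G = G 0%N.
Proof. by rewrite /altsum big_nat1 bin0 mulr1 mulr1z. Qed.

Lemma altsumS m G : altsum m.+1 G = altsum m (G \o succn) - altsum m G.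
Proof.
have coef i : (i < m.+1)%N ->
    (-1) ^+ (m.+1 - i.+1) * 'C(m.+1, i.+1)%:Z =
    (-1) ^+ (m - i) * 'C(m, i)%:Z - (-1) ^+ (m - i.+1) * 'C(m, i.+1)%:Z.
  rewrite ltnS leq_eqVlt subSS binS PoszD mulrDr => /orP[/eqP ->|im].
    by rewrite (bin_small (ltnSn m)) !mulr0 subr0 add0r.
  rewrite -(subnSK im) exprS mulN1r . ring.
rewrite /altsum [LHS]big_nat_recl//. rewrite bin0 subn0 mulr1.
under eq_big_nat => i /andP[_ im] do rewrite coef// mulrzBr.
rewrite sumrB [X in _ = _ - X]big_nat_recl// bin0 subn0 mulr1.
rewrite [X in _ + (_ - X) = _]big_nat_recr//= bin_small// mulr0 mulr0z addr0.
by rewrite exprS mulN1r mulrNz opprD [LHS]addrCA.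
Qed.

Lemma altsumB m G H :
  altsum m (fun i => G i - H i) = altsum m G - altsum m H.
Proof.
by rewrite /altsum -sumrB; apply: eq_bigr => i _; rewrite mulrzBl.
Qed.

Lemma altsum_mulrn m k G : altsum m (fun i => G i *+ k) = altsum m G *+ k.
Proof.
by rewrite /altsum -sumrMnl; apply: eq_bigr => i _; rewrite !pmulrn mulrzAC.
Qed.

Lemma altsum_sum m (I : Type) (r : seq I) (P : pred I) (G : I -> nat -> Y) :
  altsum m (fun i => \sum_(k <- r | P k) G k i) =
  \sum_(k <- r | P k) altsum m (G k).
Proof.
by rewrite /altsum exchange_big; apply: eq_bigr => i _; rewrite mulrz_suml.
Qed.

Lemma altsum_head m G : (forall i, (0 < i <= m)%N -> G i = 0) ->
  altsum m G = G 0%N *~ (-1) ^+ m.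
Proof.
move=> G0; rewrite /altsum big_nat_recl// bin0 mulr1 subn0.
by rewrite big_nat big1 ?addr0// => i /andP[_ im]; rewrite G0// mul0rz.
Qed.

Lemma mulrz_sign_eq0 m (a : Y) : a *~ (-1) ^+ m = 0 -> a = 0.
Proof.
by move=> a0; rewrite -[a]mulr1z -(sqrr_sign _ m) expr2 mulrzA a0 mul0rz.
Qed.

End Altsum.

(** Leibniz rule for the [m.+1]-st difference of a product with an affine
    sequence; the offset [a] is what makes the induction go through. *)
Lemma altsum_mull m (a : int) (G : nat -> int) :
  altsum m.+1 (fun k => (k%:Z + a) * G k) =
  a * altsum m.+1 G + m.+1%:Z * altsum m (G \o succn).
Proof.
elim: m a G => [|m IH] a G.
  by rewrite !altsumS !altsum0 /=; ring.
rewrite altsumS (IH a G) [altsum m.+2 G]altsumS.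
rewrite (@eq_altsum _ _ ((fun k => (k%:Z + a) * G k) \o succn)
  (fun k => (k%:Z + (a + 1)) * (G \o succn) k)); last first.
  by move=> i _ /=; rewrite intS; ring.
rewrite IH !(altsumS m (G \o succn)) (intS m.+1); ring.
Qed.

Lemma altsum_expn n (a : int) : altsum n (fun k => (k%:Z + a) ^+ n) = n`!%:Z.
Proof.
elim: n a => [|n IH] a; first by rewrite altsum0.
under [altsum _ _]eq_altsum do rewrite exprS.
rewrite altsum_mull altsumS.
have sE : altsum n ((fun k => (k%:Z + a) ^+ n) \o succn) = n`!%:Z.
  rewrite -(IH (a + 1)); apply: eq_altsum => i _ /=.
  by rewrite intS [1 + _]addrC -addrA [1 + _]addrC.
by rewrite sE IH subrr mulr0 add0r factS PoszM.
Qed.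

Lemma altsum_mulrn_expn (Y : zmodType) n (c : Y) :
  altsum n (fun k => c *+ k ^ n) = c *+ n`!.
Proof.
rewrite (pmulrn c n`!) -(altsum_expn n 0) /altsum mulrz_sumr.
apply: eq_bigr => i _; rewrite addr0 mulrzz mulrzA pmulrn.
by rewrite -[i%:Z]natz -natrX natz !mulrzA.
Qed.

(** * Iterated differences *)

Section Fdiff.
Variables (V : zmodType) (Y : zmodType).
Implicit Types (H K : V -> Y) (h : V) (m n : nat).

Definition fdiff h H (x : V) : Y := H (x + h) - H x.

Lemma iter_fdiffE m h H x :
  iter m (fdiff h) H x = altsum m (fun i => H (x + h *+ i)).
Proof.
elim: m x => [|m IH] x; first by rewrite altsum0 addr0.
rewrite iterS {1}/fdiff !IH altsumS; congr (_ - _).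
by apply: eq_altsum => i _ /=; rewrite mulrS addrA.
Qed.

Lemma fdiff0 H x : fdiff 0 H x = 0.
Proof. by rewrite /fdiff addr0 subrr. Qed.

Lemma fdiffC h k H : fdiff h (fdiff k H) = fdiff k (fdiff h H).
Proof.
apply/funext => x; rewrite /fdiff (addrAC x k h) !opprB.
by rewrite addrACA [RHS]addrACA (addrC (- H (x + h))).
Qed.

Lemma iter_fdiffC m h k H :
  fdiff k (iter m (fdiff h) H) = iter m (fdiff h) (fdiff k H).
Proof. by elim: m => //= m IH; rewrite fdiffC IH. Qed.

Lemma iter_iter_fdiffC m k h l H :
  iter m (fdiff h) (iter k (fdiff l) H) =
  iter k (fdiff l) (iter m (fdiff h) H).
Proof. by elim: m => //= m ->; rewrite iter_fdiffC. Qed.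

Lemma iter_fdiffB m h H K x :
  iter m (fdiff h) (fun y => H y - K y) x =
  iter m (fdiff h) H x - iter m (fdiff h) K x.
Proof. by rewrite !iter_fdiffE altsumB. Qed.

Lemma iter_fdiff_mulrn m h k H x :
  iter m (fdiff h) (fun y => H y *+ k) x = iter m (fdiff h) H x *+ k.
Proof. by rewrite !iter_fdiffE altsum_mulrn. Qed.

Lemma iter_fdiff_dilate m h k H x :
  iter m (fdiff h) (fun y => H (y *+ k)) x =
  iter m (fdiff (h *+ k)) H (x *+ k).
Proof.
rewrite !iter_fdiffE; apply: eq_altsum => i _.
by rewrite mulrnDl mulrnAC.
Qed.

Lemma iter_fdiff_opp m h H x :
  iter m (fdiff (- h)) H x = iter m (fdiff h) H (x - h *+ m) *~ (-1) ^+ m.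
Proof.
elim: m x => [|m IH] x; first by rewrite subr0 mulr1z.
rewrite !iterS {1}/fdiff !IH -mulrzBl exprS mulN1r mulrNz -mulNrz.
rewrite /fdiff opprB mulrSr opprD (addrAC x) addrA.
by congr ((_ - _) *~ _); rewrite subrK.
Qed.

End Fdiff.

(** * Functions with vanishing differences on the half-line *)

Section HalfLine.
Variables (R : realFieldType) (Y : zmodType).
Implicit Types (F H : R -> Y) (c p q x y z w : R).

Definition fdiff_null N F := forall x y, x <= 0 -> y <= 0 ->
  iter N (fdiff y) F x = 0.

(** A progression of positive step is read backwards, which changes the
    alternating sum by a sign. *)
Lemma fdiff_null_itv N F p q : fdiff_null N F ->
  p <= 0 -> p + q *+ N <= 0 -> altsum N (fun i => F (p + q *+ i)) = 0.
Proof.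
move=> F0 p0 pN0; rewrite -iter_fdiffE; have [q0|q0] := leP q 0.
  exact: F0.
have e := iter_fdiff_opp N q F (p + q *+ N).
rewrite (F0 _ (- q)) ?oppr_le0 ?(ltW q0)// addrK in e.
exact: mulrz_sign_eq0 (esym e).
Qed.

(** The mixed difference of [F] with the steps [(j - i) d], for [(j, d)] in
    [l]: each step moves along an arithmetic progression with [i] and vanishes
    at [i = j]. *)
Definition fdiff_fan (l : seq (nat * R)) (i : nat) F : R -> Y :=
  foldr (fun jd => fdiff ((jd.1%:R - i%:R) * jd.2)) F l.

(** Removing one pair [(j, d)] from [l] replaces the progression [p + i q] by
    itself and by [p + i q + (j - i) d = (p + j d) + i (q - d)], again a
    progression.  Each removal moves the endpoints [i = 0] and [i = N] to the
    right by at most [c], hence the margin [c *+ size l]. *)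
Lemma altsum_fdiff_fan N F c l p q : fdiff_null N F -> 0 <= c ->
  (forall jd, jd \in l ->
     jd.1%:R * jd.2 <= c /\ (jd.1%:R - N%:R) * jd.2 <= c) ->
  p + c *+ size l <= 0 -> p + q *+ N + c *+ size l <= 0 ->
  altsum N (fun i => fdiff_fan l i F (p + q *+ i)) = 0.
Proof.
move=> F0 c0; elim: l p q => [|[j d] l IH] p q lc.
  by rewrite mulr0n !addr0 => p0 pN0; apply: fdiff_null_itv.
have [jc jNc] : j%:R * d <= c /\ (j%:R - N%:R) * d <= c.
  by apply: (lc (j, d)); rewrite mem_head.
have {}lc jd : jd \in l -> jd.1%:R * jd.2 <= c /\ (jd.1%:R - N%:R) * jd.2 <= c.
  by move=> jdl; apply: lc; rewrite in_cons jdl orbT.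
rewrite /= !mulrS => p0 pN0; rewrite altsumB.
have step i : p + q *+ i + (j%:R - i%:R) * d = p + j%:R * d + (q - d) *+ i.
  by rewrite -(mulr_natr q) -(mulr_natr (q - d)); ring.
under [altsum _ _]eq_altsum do rewrite step.
rewrite !IH ?subrr//.
- lra.
- lra.
- lra.
- by rewrite mulrnBl -(mulr_natr d); lra.
Qed.

Lemma fdiff_fan_null l i F x : i \in [seq jd.1 | jd <- l] ->
  fdiff_fan l i F x = 0.
Proof.
elim: l x => // -[j d] l IH x; rewrite in_cons /= => /predU1P[<-|il].
  by rewrite subrr mul0r fdiff0.
by rewrite /fdiff !IH// subrr.
Qed.

Lemma fdiff_cst H (a : Y) h : (forall x, x <= 0 -> H x = a) -> h <= 0 ->
  forall x, x <= 0 -> fdiff h H x = 0.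
Proof. by move=> Ha h0 x x0; rewrite /fdiff !Ha ?subrr// -[leRHS]addr0 lerD. Qed.

Lemma iter_fdiff_null m H h : (forall x, x <= 0 -> H x = 0) -> h <= 0 ->
  forall x, x <= 0 -> iter m (fdiff h) H x = 0.
Proof.
move=> H0 h0; elim: m => //= m IH; exact: fdiff_cst IH h0.
Qed.

(** With a step below [- c], all points [x + i y] other than [x] itself lie in
    the region where [F] is already known to vanish. *)
Lemma fdiff_null_eq0 N F c : fdiff_null N F ->
  (forall x, x <= - c -> F x = 0) -> 0 <= c -> forall x, x <= 0 -> F x = 0.
Proof.
move=> F0 Fc c0 x x0; have cN0 : - c <= 0 by rewrite oppr_le0.
have := F0 x (- c) x0 cN0; rewrite iter_fdiffE altsum_head ?addr0.
  exact: mulrz_sign_eq0.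
case=> // i _; apply: Fc; rewrite mulrS addrCA gerDl.
by rewrite -[leRHS]addr0 lerD// mulrn_wle0.
Qed.

(** At [i = 0] the pair [(j, z / j)] contributes the step [z]. *)
Lemma fdiff_fan_harmonic n F w z x :
  fdiff_fan ((1%N, w) :: [seq (j, z / j%:R) | j <- iota 2 n]) 0 F x =
  fdiff w (iter n (fdiff z) F) x.
Proof.
rewrite /fdiff_fan /= subr0 mul1r; congr (fdiff _ _ _).
elim: n 2%N (isT : (0 < 2)%N) => // n IH k k0 /=.
by rewrite IH// subr0 mulrC divfK// pnatr_eq0 -lt0n.
Qed.

(** Djoković's polarization: the [j]-th difference gets the parameter [z / j],
    so that division takes place in the steps and not in [Y]. *)
Lemma fdiff_iter_fdiff_null n F w z : fdiff_null n.+1 F -> w <= 0 -> z <= 0 ->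
  forall x, x <= 0 -> fdiff w (iter n (fdiff z) F) x = 0.
Proof.
move=> F0 w0 z0.
(* c bounds the steps (j - i) d for i = 0 and i = n.+1, because every d lies
   between w + z and 0. *)
pose c : R := - (w + z) *+ n.+1.
have wz0 : 0 <= - (w + z) by lra.
have c0 : 0 <= c by rewrite mulrn_wge0.
apply: (@fdiff_null_eq0 n.+1 _ (c *+ n.+1)); rewrite ?mulrn_wge0//.
  move=> x y x0 y0; rewrite -iter_fdiffC iter_iter_fdiffC.
  rewrite (fdiff_cst (a := 0))// => {x0}x x0.
  by apply: iter_fdiff_null => // {x0}x x0; apply: F0.
move=> x xc.
pose l := (1%N, w) :: [seq (j, z / j%:R) | j <- iota 2 n].
have sl : size l = n.+1 by rewrite /= size_map size_iota.
have bnd (j : nat) (d : R) : (0 < j)%N -> d <= 0 -> w + z <= d ->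
    j%:R * d <= c /\ (j%:R - n.+1%:R) * d <= c.
  move=> j0 d0 dwz; split; first exact: le_trans (mulr_ge0_le0 _ _) c0.
  have : j%:R * d <= 0 by exact: mulr_ge0_le0.
  have : n.+1%:R * (w + z) <= n.+1%:R * d by rewrite ler_wpM2l.
  by rewrite /c -(mulr_natr (- (w + z))); lra.
have := @altsum_fdiff_fan n.+1 F c l x 0 F0 c0.
rewrite sl !mul0rn !addr0; under [altsum _ _]eq_altsum do rewrite mul0rn addr0.
rewrite altsum_head; last first.
  move=> i i1n; apply: fdiff_fan_null; rewrite /= -map_comp map_id_in//.
  by rewrite in_cons mem_iota; lia.
rewrite fdiff_fan_harmonic => e.
apply/mulrz_sign_eq0/e; [|lra..] => jd; rewrite in_cons => /predU1P[->|].
  by apply: bnd => //=; lra.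
move=> /mapP[j]; rewrite mem_iota => /andP[j2 _] ->; apply: bnd => /=.
- by lia.
- by rewrite mulr_le0_ge0// invr_ge0.
- have : z <= z / j%:R.
    rewrite -[leLHS]mulr1 ler_wnM2l// invf_le1 ?ler1n ?ltr0n//; lia.
  lra.
Qed.

Lemma iter_fdiff_cst n F x z : fdiff_null n.+1 F -> x <= 0 -> z <= 0 ->
  iter n (fdiff z) F x = iter n (fdiff z) F 0.
Proof.
move=> F0 x0 z0; apply/eqP; rewrite -subr_eq0; apply/eqP.
have := @fdiff_iter_fdiff_null n F x z F0 x0 z0 0 (lexx _).
by rewrite /fdiff add0r.
Qed.

(** The step [k z] is a succession of [k] steps [z], each contributing [a]. *)
Lemma fdiff_natmul H (a : Y) z : (forall x, x <= 0 -> fdiff z H x = a) ->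
  z <= 0 -> forall k x, x <= 0 -> fdiff (z *+ k) H x = a *+ k.
Proof.
move=> Ha z0; elim=> [|k IH] x x0; first by rewrite mulr0n fdiff0.
rewrite [RHS]mulrSr -(IH x)// -(Ha (x + z *+ k)).
  by rewrite /fdiff mulrSr addrA [RHS]addrC addrA subrK.
by rewrite -[leRHS]addr0 lerD// mulrn_wle0.
Qed.

Lemma iter_fdiff_natmul m H (a : Y) z :
  (forall x, x <= 0 -> iter m (fdiff z) H x = a) -> z <= 0 ->
  forall k x, x <= 0 -> iter m (fdiff (z *+ k)) H x = a *+ k ^ m.
Proof.
move=> + z0 k; elim: m H => [|m IH] H Ha x x0; first by rewrite mulr1n -(Ha x).
rewrite iterS expnSr mulrnA; apply: fdiff_natmul => // {x0}x x0.
by rewrite iter_fdiffC IH// => {x0}x x0; rewrite -iterSr Ha.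
Qed.

(** Up to division by [n!], this is the statement that [y |-> Delta_y^n F 0]
    is a monomial of degree [n]. *)
Lemma iter_fdiff_diag n F x z : fdiff_null n.+1 F -> x <= 0 -> z <= 0 ->
  iter n (fdiff z) (fun y => iter n (fdiff y) F 0) x =
  iter n (fdiff z) F 0 *+ n`!.
Proof.
move=> F0 x0 z0; rewrite -altsum_mulrn_expn.
transitivity (altsum n (fun k => iter n (fdiff z) (fun y => F (y *+ k)) x)).
  rewrite iter_fdiffE.
  under [LHS]eq_altsum do rewrite iter_fdiffE.
  rewrite /altsum; under eq_bigr do rewrite mulrz_suml.
  rewrite exchange_big /=; apply: eq_bigr => k _.
  rewrite iter_fdiffE mulrz_suml; apply: eq_bigr => i _.
  by rewrite add0r mulrzAC.
apply: eq_altsum => k _; rewrite iter_fdiff_dilate.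
apply: iter_fdiff_natmul; rewrite ?mulrn_wle0// => y y0.
exact: iter_fdiff_cst.
Qed.

(** Subtracting the leading monomial lowers by one the order of the vanishing
    differences, because it has the same [n]-th differences as [F]. *)
Lemma fdiff_null_decomposition n F :
  (forall i, (i < n)%N -> divisible i`! Y) -> fdiff_null n F ->
  exists r : nat -> R -> Y,
    (forall i x y, (i < n)%N -> x <= 0 -> y <= 0 ->
       iter i (fdiff y) (r i) x = r i y *+ i`!) /\
    (forall x, x <= 0 -> F x = \sum_(i < n) r i x).
Proof.
elim: n F => [|n IH] F dY F0.
  exists (fun _ _ => 0); split => // x x0; rewrite big_ord0.
  exact: (F0 x 0 x0 (lexx _)).
have [g gK Kg] := dY n (ltnSn n).
pose rho y := g (iter n (fdiff y) F 0).
have rhoE x z : x <= 0 -> z <= 0 ->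
    iter n (fdiff z) rho x = iter n (fdiff z) F 0.
  move=> x0 z0; apply: (can_inj gK); rewrite -(iter_fdiff_diag F0 x0 z0).
  rewrite -iter_fdiff_mulrn; congr (iter _ _ _ _).
  by apply/funext => y; apply: Kg.
have [||r [rP rF]] := IH (fun x => F x - rho x).
- by move=> i /ltnW; apply: dY.
- by move=> x y x0 y0; rewrite iter_fdiffB rhoE// iter_fdiff_cst// subrr.
exists (fun i => if i == n then rho else r i); split=> [i x y|x x0].
  rewrite ltnS leq_eqVlt; case: eqVneq => [-> _ x0 y0|_ /= ? ? ?].
    by rewrite rhoE// Kg.
  exact: rP.
rewrite big_ord_recr/= eqxx -[LHS](subrK (rho x)) rF//; congr (_ + _).
by apply: eq_bigr => i _; rewrite (ltn_eqF (ltn_ord i)).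
Qed.

(** The [i]-th difference of a monomial does not depend on the base point, so
    one more difference annihilates it. *)
Lemma fdiff_null_monomial n i F :
  (forall x y, x <= 0 -> y <= 0 -> iter i (fdiff y) F x = F y *+ i`!) ->
  (i < n)%N -> fdiff_null n F.
Proof.
move=> Fi /subnK <- x y x0 y0; rewrite iterD.
by apply: iter_fdiff_null => // {x0}x x0; apply: fdiff_cst; eauto.
Qed.

End HalfLine.

(** * From the sine to the half-line *)

Lemma divisible_dvd (Y : zmodType) (d m : nat) :
  (d %| m)%N -> divisible m Y -> divisible d Y.
Proof.
move=> /dvdnP[q ->] [g gK Kg]; exists (fun y => g (y *+ q)) => y.
  by rewrite -mulrnA mulnC gK.
by apply: (can_inj gK); rewrite mulrnAC Kg mulrnA.
Qed.

Section Transfer.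
Variables (R : realType) (Y : zmodType).
Implicit Types (u v : nonpi R) (x y : R) (f : nonpi R -> Y).

Lemma Delta_fdiff j (rho : nonpos R -> Y) (H : R -> Y) (x y : nonpos R) :
  (forall z : nonpos R, rho z = H z) ->
  Delta j y rho x = iter j (fdiff (y : R)) H (x : R).
Proof.
move=> rhoH; rewrite iter_fdiffE; apply: eq_altsum => i _.
rewrite rhoH; congr H; elim: i => [|i IH]; first by rewrite addr0.
by rewrite iterS mulrSr addrA -IH.
Qed.

Fact clip_le0 x : Num.min x 0 <= 0. Proof. by rewrite ge_min lexx orbT. Qed.

(** The differences of the previous part live on functions of a real argument;
    [clip] extends functions on the half-line to such functions, and only their
    values on the half-line matter. *)
Definition clip x : nonpos R := Nonpos (Num.min x 0) (clip_le0 x).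

Lemma clipK (z : nonpos R) : clip z = z.
Proof. by apply: val_inj; rewrite /= min_l// nonpos_le0. Qed.

Lemma clip_val x : x <= 0 -> clip x = x :> R.
Proof. by move=> x0; rewrite /= min_l. Qed.

Lemma sin_asin_expR (z : nonpos R) : sin (asin (expR z)) = expR z.
Proof.
apply: asinK; rewrite in_itv/= -expR0 ler_expR nonpos_le0 andbT.
by apply: le_trans (expR_ge0 _); rewrite expR0 lerN10.
Qed.

Fact asin_expR_nonpi (z : nonpos R) :
  ~ exists k : int, asin (expR z) = k%:~R * pi.
Proof.
move=> [k e]; have := expR_gt0 (z : R).
by rewrite -sin_asin_expR e sin_int_mul_pi ltxx.
Qed.

Definition asin_exp (z : nonpos R) : nonpi R :=
  Nonpi (asin (expR z)) (@asin_expR_nonpi z).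

Definition ln_sin u : nonpos R := Nonpos (ln `|sin u|) (ln_sin_le0 u).

Lemma asin_expK : cancel asin_exp ln_sin.
Proof.
move=> z; apply: val_inj; rewrite /= sin_asin_expR ger0_norm ?expR_ge0//.
exact: expRK.
Qed.

Lemma nonpi_val_inj : injective (@nonpi_val R).
Proof.
move=> [a pa] [b pb] /= ab; subst b.
by congr Nonpi; apply: Prop_irrelevance.
Qed.

Definition on_line f x : Y := f (asin_exp (clip x)).

Lemma on_lineE f u v i :
  f (Nonpi (asin `|sin u * sin v ^+ i|) (asin_sin_nonpi u v i)) =
  on_line f ((ln_sin u : R) + (ln_sin v : R) *+ i).
Proof.
have le0 : (ln_sin u : R) + (ln_sin v : R) *+ i <= 0.
  by rewrite -[leRHS]addr0 lerD ?mulrn_wle0// nonpos_le0.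
congr f; apply: nonpi_val_inj; rewrite /= min_l// expRD -mulr_natr expRM_natr.
by rewrite !lnK ?posrE ?normr_gt0 ?nonpi_sin_neq0// normrM normrX.
Qed.

(** The choice [|sin v| = 1], i.e. step [0], forces [f] to factor through
    [ln |sin u|]; after that, the left-hand side is, up to sign, the difference
    of order [n.+1] at [ln |sin u|] with step [ln |sin v|], and these two
    numbers are arbitrary in the half-line. *)
Lemma sin_eq_fdiff n f :
  (forall u v : nonpi R,
     f u + \sum_(1 <= i < n.+2)
             f (Nonpi (asin `|sin u * sin v ^+ i|) (asin_sin_nonpi u v i))
               *~ ((-1) ^+ i * 'C(n.+1, i)%:Z) = 0) <->
  (forall u, f u = on_line f (ln_sin u)) /\ fdiff_null n.+1 (on_line f).
Proof.
have sumE u v :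
  on_line f (ln_sin u) + \sum_(1 <= i < n.+2)
     f (Nonpi (asin `|sin u * sin v ^+ i|) (asin_sin_nonpi u v i))
       *~ ((-1) ^+ i * 'C(n.+1, i)%:Z) =
  iter n.+1 (fdiff (ln_sin v : R)) (on_line f) (ln_sin u : R) *~ (-1) ^+ n.+1.
  rewrite iter_fdiffE /altsum mulrz_suml [RHS]big_ltn// bin0 subn0 mulr1.
  rewrite -mulrzA -expr2 sqrr_sign mulr1z addr0; congr (_ + _).
  apply: eq_big_nat => i /andP[_ im]; rewrite on_lineE -mulrzA mulrAC.
  have -> : (-1) ^+ n.+1 = (-1) ^+ (n.+1 - i) * (-1) ^+ i :> int.
    by rewrite -exprD subnK.
  by rewrite mulrA -expr2 sqrr_sign mul1r.
split=> [fE|[fL f0] u v]; last first.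
  by rewrite fL sumE f0 ?mul0rz// nonpos_le0.
have fL u : f u = on_line f (ln_sin u).
  pose v := asin_exp (clip 0).
  have v0 : (ln_sin v : R) = 0 by rewrite asin_expK clip_val.
  have := sumE u v; rewrite v0 iter_fdiffE altsumS.
  under [X in _ - X]eq_altsum do rewrite mul0rn.
  under [X in X - _]eq_altsum do rewrite /= mul0rn.
  by rewrite subrr mul0rz => e; exact: addIr (etrans (fE u v) (esym e)).
split=> // x y x0 y0; have := sumE (asin_exp (clip x)) (asin_exp (clip y)).
rewrite -fL fE !asin_expK !clip_val// => /esym; exact: mulrz_sign_eq0.
Qed.

End Transfer.

Theorem theorem4p2 (R : realType) (n : nat) (Y : zmodType) (f : nonpi R -> Y) :
  (1 <= n)%N ->
  divisible n`! Y ->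
  ((forall u v : nonpi R,
     f u + \sum_(1 <= i < n.+2)
             f (Nonpi (asin `|sin u * sin v ^+ i|) (asin_sin_nonpi u v i))
               *~ ((-1) ^+ i * 'C(n.+1, i)%:Z) = 0)
  <->
  (exists rho : 'I_n.+1 -> nonpos R -> Y,
     (forall i : 'I_n.+1, rho i \in monomials i (nonpos R) Y) /\
     (forall u : nonpi R,
        f u = \sum_(i < n.+1)
                rho i (Nonpos (ln `|sin u|) (ln_sin_le0 u))))).
Proof.
move=> _ dY; apply: iff_trans (sin_eq_fdiff n f) _; split.
  move=> [fL f0].
  have [i|r [rP rE]] := fdiff_null_decomposition _ f0.
    rewrite ltnS => iln; apply: divisible_dvd dY.
    by rewrite -(bin_fact iln) dvdn_mull// dvdn_mulr.
  exists (fun i (z : nonpos R) => r i (z : R)); split=> [i|u];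
    last by rewrite fL rE ?nonpos_le0.
  rewrite inE => x y; rewrite (@Delta_fdiff _ _ _ _ (r i))//.
  by rewrite rP ?nonpos_le0.
move=> [rho [rhoP fE]].
have lE x : x <= 0 -> on_line f x = \sum_(i < n.+1) rho i (clip x).
  move=> x0; rewrite /on_line fE; apply: eq_bigr => i _.
  by congr (rho i _); exact: asin_expK.
split=> [u|x y x0 y0].
  by rewrite lE ?nonpos_le0// fE; apply: eq_bigr => i _; rewrite clipK.
rewrite iter_fdiffE.
transitivity (altsum n.+1 (fun k => \sum_(i < n.+1) rho i (clip (x + y *+ k)))).
  by apply: eq_altsum => k _; rewrite lE// -[leRHS]addr0 lerD ?mulrn_wle0.
rewrite altsum_sum big1// => i _.
rewrite -(iter_fdiffE _ _ (fun z => rho i (clip z))).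
apply: (@fdiff_null_monomial _ _ n.+1 i) => // {x y x0 y0} x y x0 y0.
have := rhoP i; rewrite inE => /(_ (clip x) (clip y)).
rewrite (@Delta_fdiff _ _ _ _ (fun z => rho i (clip z))) ?clip_val// => z.
by rewrite clipK.
Qed.
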